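(* For $1<\alpha<2$, $\beta<\alpha+1$, and $\beta-\alpha\notin\mathbb{Z}_{\le 0}$, we have that $$\left|g_{\alpha,\beta-\alpha}(t)\right|\le\varepsilon\left|\frac{t^{-\alpha+\beta-1}}{\Gamma(-\alpha+\beta)}\right|\qquad\text{for } t\ge T_\varepsilon(\alpha,\beta),$$ where $$T_\varepsilon(\alpha,\beta)=\frac{\alpha+1-\beta}{\cos(\pi/\alpha)}\,W_{-1}\!\left(\frac{\cos(\pi/\alpha)}{\alpha+1-\beta}\left(\frac{\alpha}{2}\,\frac{\varepsilon}{|\Gamma(-\alpha+\beta)|}\right)^{\frac{1}{\alpha+1-\beta}}\right).$$
   Context: Here $\beta$ is real, $\varepsilon>0$ is a tolerance, and $\Gamma$ is the (analytically continued) Gamma function. For $\alpha\in(1,2)$, $b\in\mathbb{R}$ and $t>0$, $$g_{\alpha,b}(t)=\frac{2}{\alpha}\,e^{t\cos(\pi/\alpha)}\cos\!\left(\sin(\pi/\alpha)\,t-(b-1)\frac{\pi}{\alpha}\right);$$ in the claim this is used with $b=\beta-\alpha$. $W_{-1}$ is the $-1$ branch of the Lambert $W$ function, whose branches $y=W(z)$ solve $ye^y=z$; for $z\in[-1/e,0)$, $W_{-1}(z)$ is the real solution with $y\le-1$. *)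

(* Defs.v *)
From mathcomp Require Import all_boot all_order all_algebra.
From mathcomp Require Import all_classical all_reals all_analysis.

Set Implicit Arguments.
Unset Strict Implicit.
Unset Printing Implicit Defensive.

Import Order.TTheory GRing.Theory Num.Theory.
Import numFieldNormedType.Exports.

Local Open Scope classical_set_scope.
Local Open Scope ring_scope.

Definition euler_integral (R : realType) (x : R) : R :=
  \int[lebesgue_measure]_(s in `]0, +oo[) (s `^ (x - 1) * expR (- s)).

Definition gamma_shift (R : realType) (x : R) : nat :=
  if 0 < x then 0%N else (Num.truncn (- x)).+1.

(* The Gamma function on the real line, continued to negative x through
   Gamma (x + 1) = x * Gamma x, where gamma_shift x is the least n such that
   0 < x + n. At the poles 0, -1, -2, ... one of the factors vanishes, so that
   the value is 0 and carries no meaning. *)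
Definition Gamma (R : realType) (x : R) : R :=
  euler_integral (x + (gamma_shift x)%:R) /
    \prod_(k < gamma_shift x) (x + k%:R).

(* The set below is a singleton for -1/e <= z < 0, the domain on which the
   branch W_{-1} is real, and empty otherwise; the value is then 0. *)
Definition LambertWm1 (R : realType) (z : R) : R :=
  xget 0 [set y : R | y <= -1 /\ y * expR y = z].

Definition g (R : realType) (alpha b t : R) : R :=
  2 / alpha * expR (t * cos (pi / alpha)) *
    cos (sin (pi / alpha) * t - (b - 1) * (pi / alpha)).

Definition Teps (R : realType) (alpha beta eps : R) : R :=
  (alpha + 1 - beta) / cos (pi / alpha) *
    LambertWm1 (cos (pi / alpha) / (alpha + 1 - beta) *
      (alpha / 2 * (eps / `|Gamma (- alpha + beta)|))
        `^ (1 / (alpha + 1 - beta))).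

(* Main.v *)
Require Import Defs.
From mathcomp Require Import all_boot all_order all_algebra.
From mathcomp Require Import all_classical all_reals all_analysis.
From mathcomp Require Import measurable_realfun lra ring.

Import Order.TTheory GRing.Theory Num.Theory.
Import numFieldNormedType.Exports.

Local Open Scope classical_set_scope.
Local Open Scope ring_scope.

(** Put [p = alpha + 1 - beta > 0], [c = cos (pi / alpha)] and
    [K = alpha / 2 * eps / |Gamma (beta - alpha)|]. Since [1 < alpha < 2], the
    angle [pi / alpha] lies between [pi / 2] and [pi], so that [c < 0]. Bounding
    the oscillating cosine in [g] by 1, it suffices to show
    [t ^ p * exp (c * t) <= K], or, taking [p]-th roots and writing [q = c / p],
    [t * exp (q * t) <= K ^ (1 / p)]. Multiplying by [q < 0] and putting
    [y = q * t], this becomes [y * exp y >= z] with [z = q * K ^ (1 / p)], while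
    the hypothesis [t >= Teps alpha beta eps] reads [y <= W_{-1} z].

    This last implication is [mulr_expR_ge_LambertWm1]. If [-1/e <= z < 0], then
    [W_{-1} z <= -1] solves [w * exp w = z] and [y * exp y] decreases on
    [y <= -1]; if [z < -1/e], nothing is needed, as [y * exp y >= -1/e] always.

    The right-hand side contains a division by [Gamma (beta - alpha)], which has
    to be nonzero ([Gamma_neq0]). Away from the poles this reduces to the
    positivity of Euler's integral at [x > 0]. The integrand being positive, what
    remains is convergence ([euler_integral_lty]): as
    [(1 + s) ^ (x + 1) <= C * exp s], the integrand is at most a constant times
    [x * s ^ (x - 1) / (1 + s) ^ (x + 1)], the derivative of the bounded function
    [(s / (1 + s)) ^ x]. *)

(** * The function y exp y and the branch W_{-1} *)

(** The minimum of [y * expR y], reached at [y = -1], is [- 1/e]. *)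
Lemma mulr_expR_lbound (R : realType) (y : R) : - expR (- 1) <= y * expR y.
Proof.
have h : - y <= expR (- (1 + y)).
  by apply: le_trans (expR_ge1Dx _); lra.
rewrite lerNl -mulNr.
have -> : expR (- 1) = expR (- (1 + y)) * expR y :> R.
  by rewrite -expRD; congr expR; ring.
by rewrite ler_wpM2r// expR_ge0.
Qed.

(** For [y <= -1] the function [y * expR y] decreases. No derivative is needed:
    this follows from [expR u >= 1 + u] at [u = w - y]. *)
Lemma mulr_expR_antitone (R : realType) (y w : R) :
  y <= w -> w <= -1 -> w * expR w <= y * expR y.
Proof.
move=> yw w1.
have h : 1 + (w - y) <= expR (w - y) by exact: expR_ge1Dx.
have -> : expR w = expR (w - y) * expR y.
  by rewrite -expRD; congr expR; ring.
rewrite mulrA ler_wpM2r ?expR_ge0//.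
apply: (@le_trans _ _ (w * (1 + (w - y)))); last by nra.
by rewrite ler_wnM2l//; lra.
Qed.

(** For [-1/e <= z < 0] the value [LambertWm1 z] is a genuine solution. *)
Lemma LambertWm1_spec (R : realType) (z : R) : - expR (- 1) <= z -> z < 0 ->
  LambertWm1 z <= -1 /\ LambertWm1 z * expR (LambertWm1 z) = z.
Proof.
move=> z1 z0.
suff [y [y1 yz]] : exists y : R, y <= -1 /\ y * expR y = z.
  exact: (@xgetPex _ 0 [set y : R | y <= -1 /\ y * expR y = z]%classic
            (ex_intro _ y (conj y1 yz))).
(* The intermediate value theorem applies on [- m, -1] with m = max(1, -2/z):
   since expR m >= m^2 / 2, the value at - m is at least - 2 / m >= z. *)
pose m := Num.max 1 (- 2 / z).
have m1 : 1 <= m by rewrite le_max lexx.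
have m2 : - 2 / z <= m by rewrite le_max lexx orbT.
have mz : z <= - m * expR (- m).
  have mz2 : m * z <= - 2 by rewrite -ler_ndivrMr.
  have em : 1 + m ^+ 2 / 2 <= expR m.
    have := expR_ge1Dxn 1 (le_trans ler01 m1).
    by rewrite (_ : 2`!%N = 2).
  rewrite expRN ler_pdivlMr ?expR_gt0//.
  nra.
have cf : {within `[- m, -1]%classic, continuous (fun y : R => y * expR y)}.
  apply: continuous_subspaceT => y.
  by apply: cvgM; [exact: cvg_id|exact: continuous_expR].
have [||y ymem yz] := @IVT R _ _ _ z _ cf.
- by lra.
- by rewrite ge_min le_max mulN1r z1 mz orbT.
- exists y; split => //.
  by move: ymem; rewrite in_itv/= => /andP[].
Qed.

(** For [z < - 1/e] the conclusion holds for every [y], because [z] lies below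
    the minimum of [y * expR y]; the default value of [LambertWm1] at such [z]
    is therefore harmless. *)
Lemma mulr_expR_ge_LambertWm1 (R : realType) (z y : R) :
  z < 0 -> y <= LambertWm1 z -> z <= y * expR y.
Proof.
move=> z0 yW.
have [z1|z1] := leP (- expR (- 1)) z.
  have [W1 Wz] := @LambertWm1_spec R z z1 z0.
  by rewrite -[leLHS]Wz mulr_expR_antitone.
by rewrite (le_trans (ltW z1))// mulr_expR_lbound.
Qed.

(** * Positivity of Euler's integral and nonvanishing of Gamma *)

Lemma powR1D_le_expR (R : realType) (m s : R) : 1 <= m -> 0 <= s ->
  (1 + s) `^ m <= m `^ m * expR s.
Proof.
move=> m1 s0.
have m0 : 0 < m by lra.
have mN0 : m != 0 by rewrite gt_eqF.
have h : 1 + s <= m * expR (s / m).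
  apply: (@le_trans _ _ (m * (1 + s / m))).
    by rewrite mulrDr mulrCA divff// mulr1; lra.
  by rewrite ler_pM2l// expR_ge1Dx.
have -> : m `^ m * expR s = (m * expR (s / m)) `^ m.
  by rewrite powRM ?expR_ge0 ?ltW// -expRM -mulrA mulVf// mulr1.
by apply: ge0_ler_powR; rewrite ?nnegrE; try lra; exact: le_trans h.
Qed.

(** For [x > 0], a primitive with values between 0 and 1 of a function that is of
    the order of [s `^ (x - 1)] near 0 and of [s ^- 2] at infinity. *)
Lemma is_derive_powR_frac (R : realType) (x s : R) : 0 < s ->
  is_derive s 1 (fun u : R => (u / (1 + u)) `^ x)
    (x * s `^ (x - 1) / (1 + s) `^ (x + 1)).
Proof.
move=> s0.
have s1 : 0 < 1 + s by lra.
have w0 : 0 < s / (1 + s) by rewrite divr_gt0.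
have d1 : is_derive s 1 (fun u : R => u / (1 + u)) ((1 + s) ^- 2).
  have -> : (fun u : R => u / (1 + u)) = (id * (fun u : R => (1 + u)^-1)) by [].
  have dV : is_derive s 1 (fun u : R => (1 + u)^-1) (- (1 + s) ^- 2 *: 1).
    apply: is_deriveV.
      exact: lt0r_neq0.
    by apply: is_derive_eq; rewrite add0r.
  apply: is_derive_eq.
  rewrite /GRing.scale/=; field.
  exact: lt0r_neq0.
have d2 := is_derive1_powR x w0.
have := @is_derive1_comp R (fun w : R => w `^ x) (fun u : R => u / (1 + u)) s _ _ d2 d1.
move=> H; apply: is_derive_eq H _.
rewrite powRM ?invr_ge0; try lra.
rewrite -powR_inv1 ?ltW// -powRrM mulN1r powRN.
have -> : (1 + s) `^ (x + 1) = (1 + s) `^ (x - 1) * (1 + s) ^+ 2.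
  rewrite -powR_mulrn ?ltW// -powRD; last by rewrite lt0r_neq0 ?implybT.
  by congr (_ `^ _); ring.
field.
by rewrite !lt0r_neq0// powR_gt0.
Qed.

(** A bounded primitive [F] bounds the integral over the half-line of a
    nonnegative continuous [f]. The function [f] may be
    unbounded near 0, which is why the half-line is exhausted by the compact
    intervals from [1/(n+1)] to [n+2], on which the fundamental theorem applies. *)
Lemma ge0_integral_itv0y_le (R : realType) (f F : R -> R) (M : R) :
  (forall s, 0 < s -> 0 <= f s) ->
  (forall s, 0 < s -> {for s, continuous f}) ->
  (forall s : R, 0 < s -> is_derive s 1 F (f s)) ->
  (forall s, 0 < s -> 0 <= F s <= M) ->
  (\int[lebesgue_measure]_(s in `]0%R, +oo[) (f s)%:E <= M%:E)%E.
Proof.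
move=> f0 cf dF F0M.
pose I (n : nat) : set R := `[n.+1%:R^-1, n.+2%:R]%classic.
have Ipos n s : I n s -> 0 < s.
  by rewrite /I/= in_itv/= => /andP[+ _]; apply: lt_le_trans; rewrite invr_gt0.
have IE : `]0, +oo[%classic = (\bigcup_n I n)%classic.
  apply/seteqP; split => [s|s [n _ /Ipos s0]]; last by rewrite /= in_itv/= s0.
  rewrite /= in_itv/= andbT => s0.
  exists (maxn (Num.truncn s) (Num.truncn s^-1)) => //.
  rewrite /I/= in_itv/=; apply/andP; split.
    rewrite -[leRHS]invrK lef_pV2 ?posrE ?invr_gt0//.
    apply: le_trans (ltW (truncnS_gt _)) _.
    by rewrite ler_nat ltnS leq_maxr.
  apply: le_trans (ltW (truncnS_gt _)) _.
  by rewrite ler_nat ltnS leqW// leq_maxl.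
have cI n : {within I n, continuous f}.
  by apply: continuous_in_subspaceT => s; rewrite inE => /Ipos/cf.
rewrite IE.
have cvgI : (\int[lebesgue_measure]_(x in I i) (EFin \o f) x @[i --> \oo]
    --> \int[lebesgue_measure]_(x in \bigcup_i I i) (EFin \o f) x)%E.
  apply: ge0_nondecreasing_set_cvg_integral.
  - move=> m n mn; apply/subsetPset; rewrite /I => s /=; rewrite !in_itv/=.
    move=> /andP[ms sm]; rewrite (le_trans _ ms) ?(le_trans sm)//.
      by rewrite ler_nat !ltnS.
    by rewrite lef_pV2 ?posrE// ler_nat ltnS.
  - by move=> n; exact: measurable_itv.
  - move=> n; apply/measurable_EFinP.
    by apply: subspace_continuous_measurable_fun; [exact: measurable_itv|exact: cI].
  - by move=> n s /Ipos/f0; rewrite lee_fin.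
rewrite -(cvg_lim _ cvgI)//.
apply: lime_le; first by apply/cvg_ex; eexists; exact: cvgI.
apply: nearW => n /=.
have ab : n.+1%:R^-1 < n.+2%:R :> R.
  apply: (@le_lt_trans _ _ 1); last by rewrite ltr1n.
  by rewrite invf_le1// ler1n.
have a0 : 0 < n.+1%:R^-1 :> R by rewrite invr_gt0.
have cF s : 0 < s -> {for s, continuous F}.
  by move=> /dF[ds _]; apply: differentiable_continuous; exact/derivable1_diffP.
have Fab : derivable_oo_LRcontinuous F n.+1%:R^-1 n.+2%:R.
  split.
  - move=> s; rewrite in_itv/= => /andP[as_ _].
    by case: (dF s (lt_trans a0 as_)).
  - by apply: cvg_at_right_filter; exact: cF.
  - by apply: cvg_at_left_filter; exact: cF _ (lt_trans a0 ab).
have F'f : {in `]n.+1%:R^-1, n.+2%:R[, derive1 F =1 f}.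
  move=> s; rewrite in_itv/= => /andP[as_ _].
  by rewrite derive1E; case: (dF s (lt_trans a0 as_)).
rewrite (continuous_FTC2 ab (cI n) Fab F'f) -EFinB lee_fin.
have /andP[Fa _] := F0M _ a0.
have /andP[_ Fb] := F0M _ (lt_trans a0 ab).
by lra.
Qed.

(** The integrand of [euler_integral x]. *)
Definition gamma_integrand (R : realType) (x s : R) : R :=
  s `^ (x - 1) * expR (- s).

Lemma measurable_gamma_integrand (R : realType) (x : R) (D : set R) :
  measurable_fun D (gamma_integrand R x).
Proof.
apply: (@measurable_funS _ _ _ _ setT) => //.
apply: measurable_funM; first exact: measurable_powR.
by apply: measurableT_comp => //; exact: measurable_expR.
Qed.

Lemma gamma_integrand_ge0 (R : realType) (x s : R) : 0 <= gamma_integrand R x s.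
Proof. by rewrite mulr_ge0 ?powR_ge0 ?expR_ge0. Qed.

Lemma gamma_integrand_le (R : realType) (x s : R) : 0 < x -> 0 < s ->
  gamma_integrand R x s <=
    (x + 1) `^ (x + 1) / x * (x * s `^ (x - 1) / (1 + s) `^ (x + 1)).
Proof.
move=> x0 s0; rewrite /gamma_integrand.
have s1 : 0 < (1 + s) `^ (x + 1) by rewrite powR_gt0; lra.
rewrite (_ : _ * (x * _ / _) =
    s `^ (x - 1) * ((x + 1) `^ (x + 1) / (1 + s) `^ (x + 1))); last first.
  by field; rewrite !lt0r_neq0.
rewrite ler_wpM2l ?powR_ge0// ler_pdivlMr//.
rewrite expRN mulrC ler_pdivrMr ?expR_gt0//.
by apply: powR1D_le_expR; lra.
Qed.

(** Finiteness matters because [euler_integral] is real-valued, hence 0 when the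
    integral diverges. *)
Lemma euler_integral_lty (R : realType) (x : R) : 0 < x ->
  (\int[lebesgue_measure]_(s in `]0%R, +oo[) (gamma_integrand R x s)%:E < +oo)%E.
Proof.
move=> x0.
pose c := (x + 1) `^ (x + 1) / x.
pose f (s : R) := c * (x * s `^ (x - 1) / (1 + s) `^ (x + 1)).
pose F (s : R) := c * (s / (1 + s)) `^ x.
have c0 : 0 <= c by rewrite divr_ge0 ?powR_ge0// ltW.
have gf s : 0 < s -> gamma_integrand R x s <= f s by exact: gamma_integrand_le.
have cf s : 0 < s -> {for s, continuous f}.
  move=> s0.
  have cpow p u : 0 < u -> {for u, continuous (fun w : R => w `^ p)}.
    move=> u0; apply: differentiable_continuous; apply/derivable1_diffP.
    by case: (is_derive1_powR p u0).
  have s1 : 0 < 1 + s by lra.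
  apply: cvgM; first exact: cvg_cst.
  apply: cvgM.
    by apply: cvgM; [exact: cvg_cst|exact: cpow].
  apply: cvgV; first by rewrite lt0r_neq0// powR_gt0.
  apply: (@continuous_comp _ _ _ (fun w : R => 1 + w) (fun w : R => w `^ (x + 1))).
    by apply: cvgD; [exact: cvg_cst|exact: cvg_id].
  exact: cpow.
have mf : measurable_fun (`]0, +oo[ : set R) f.
  apply: open_continuous_measurable_fun => // s.
  by rewrite inE/= in_itv/= andbT => /cf.
apply: (@le_lt_trans _ _ c%:E); last exact: ltry.
apply: (@le_trans _ _ (\int[lebesgue_measure]_(s in `]0%R, +oo[) (f s)%:E)%E).
  apply: ge0_le_integral => //.
  - by move=> s _; rewrite lee_fin gamma_integrand_ge0.
  - by apply/measurable_EFinP; exact: measurable_gamma_integrand.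
  - by apply/measurable_EFinP.
  - by move=> s; rewrite /= in_itv/= andbT lee_fin => /gf.
apply: (@ge0_integral_itv0y_le _ f F) => //.
- by move=> s s0; apply: le_trans (gf s s0); exact: gamma_integrand_ge0.
- move=> s s0; have dF := is_derive_powR_frac R x s s0.
  exact: is_deriveZ.
- move=> s s0; rewrite mulr_ge0 ?powR_ge0//= ler_piMr//.
  have w1 : s / (1 + s) <= 1 by rewrite ler_pdivrMr; lra.
  have w0 : 0 <= s / (1 + s) by rewrite divr_ge0; lra.
  apply: (@le_trans _ _ (1 `^ x)); last by rewrite powR1.
  by rewrite ge0_ler_powR ?nnegrE// ltW.
Qed.

Lemma euler_integral_gt0 (R : realType) (x : R) : 0 < x -> 0 < euler_integral x.
Proof.
move=> x0; rewrite /euler_integral /Rintegral fine_gt0//.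
rewrite -/(gamma_integrand R x) euler_integral_lty// andbT.
(* On [1, 2] one has s `^ (x - 1) = s `^ x / s >= 1 / 2, as x > 0. *)
pose k : R := expR (- 2) / 2.
have k0 : 0 < k by rewrite divr_gt0 ?expR_gt0.
apply: (@lt_le_trans _ _ (\int[lebesgue_measure]_(s in `[1%R, 2%R]) k%:E)%E).
  rewrite integral_cst//= lebesgue_measure_itv/= lte_fin ltr1n -EFinD -EFinM.
  by rewrite lte_fin mulr_gt0//; lra.
apply: (@le_trans _ _
    (\int[lebesgue_measure]_(s in `[1%R, 2%R]) (gamma_integrand R x s)%:E)%E).
  apply: ge0_le_integral => //.
  - by move=> s _; rewrite lee_fin ltW.
  - by apply/measurable_EFinP; exact: measurable_gamma_integrand.
  - move=> s; rewrite /= in_itv/= => /andP[s1 s2].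
    have s0 : 0 < s by lra.
    rewrite lee_fin /k /gamma_integrand mulrC ler_pM ?invr_ge0 ?expR_ge0//.
      rewrite powRB ?lt0r_neq0 ?implybT// powRr1 ?(ltW s0)//.
      rewrite ler_pdivlMr//.
      apply: (@le_trans _ _ 1); first by lra.
      by rewrite -[leLHS](powRr0 s) ler_powR// (ltW x0).
    by rewrite ler_expR; lra.
apply: ge0_subset_integral => //.
- by apply/measurable_EFinP; exact: measurable_gamma_integrand.
- by move=> s _; rewrite lee_fin gamma_integrand_ge0.
- by move=> s; rewrite /= !in_itv/= andbT => /andP[+ _]; lra.
Qed.

Lemma Gamma_neq0 (R : realType) (x : R) :
  (forall n : nat, x <> - n%:R) -> Gamma x != 0.
Proof.
move=> xN; rewrite /Gamma mulf_neq0// ?invr_neq0//.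
  rewrite lt0r_neq0// euler_integral_gt0// /gamma_shift.
  case: ifPn => [x0|_]; first by rewrite addr0.
  by rewrite -ltrBlDl sub0r truncnS_gt.
apply/prodf_neq0 => k _; rewrite addr_eq0; apply/eqP; exact: xN.
Qed.

(** * The bound on g *)

Lemma cos_pi_div_lt0 (R : realType) (a : R) : 1 < a -> a < 2 -> cos (pi / a) < 0.
Proof.
move=> a1 a2; rewrite -(@cos_pihalf R).
have p0 := pi_gt0 R.
have ai0 : 0 < a^-1 by rewrite invr_gt0; lra.
have ai1 : a^-1 < 1 by rewrite invf_lt1//; lra.
have ai2 : 2^-1 < a^-1 by rewrite ltf_pV2// posrE; lra.
rewrite ltr_cos ?in_itv/=; first by rewrite ltr_pM2l.
  by apply/andP; split; nra.
by apply/andP; split; nra.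
Qed.

Theorem theorem13 (R : realType) (alpha beta eps : R)
  (halpha1 : 1 < alpha) (halpha2 : alpha < 2)
  (hbeta : beta < alpha + 1)
  (hpole : forall n : nat, beta - alpha <> - n%:R)
  (heps : 0 < eps) :
  forall t : R, 0 < t -> Teps alpha beta eps <= t ->
    `|g alpha (beta - alpha) t|
      <= eps * `|t `^ (- alpha + beta - 1) / Gamma (- alpha + beta)|.
Proof.
move=> t t0; rewrite /Teps /g.
have c0 : cos (pi / alpha) < 0 by exact: cos_pi_div_lt0.
have Gam0 : Gamma (- alpha + beta) != 0.
  by apply: Gamma_neq0 => n; rewrite addrC; exact: hpole.
move: (cos (pi / alpha)) c0 (Gamma _) Gam0 => c c0 Gam Gam0.
rewrite normf_div; move: `|Gam| (normr_gt0 Gam) => G; rewrite Gam0 => G0.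
have p0 : 0 < alpha + 1 - beta by lra.
rewrite (_ : - alpha + beta - 1 = - (alpha + 1 - beta)); last by ring.
move: (alpha + 1 - beta) p0 => p p0.
pose K := alpha / 2 * (eps / G).
have K0 : 0 < K by rewrite /K !mulr_gt0 ?invr_gt0//; lra.
rewrite -/K.
(* With r = K^(1/p) and q = c/p < 0, the claim follows from t * expR (q * t) <= r,
   that is, q * r <= y * expR y for y = q * t. *)
set r := K `^ (1 / p).
have r0 : 0 < r by rewrite powR_gt0.
have rp : r `^ p = K by rewrite /r -powRrM div1r mulVf ?lt0r_neq0// powRr1// ltW.
set q := c / p => hT.
have q0 : q < 0 by rewrite /q pmulr_llt0 ?invr_gt0.
have qt : q * t <= LambertWm1 (q * r).
  rewrite -[leRHS](mulVKf (ltr0_neq0 q0)) ler_nM2l//.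
  by apply: le_trans hT; rewrite /q invf_div.
have decay : t * expR (q * t) <= r.
  have := mulr_expR_ge_LambertWm1 R (q * r) (q * t).
  move=> /(_ _ qt); rewrite nmulr_rlt0// => /(_ r0).
  by rewrite -mulrA ler_nM2l.
have decayp : t `^ p * expR (t * c) <= K.
  rewrite -rp (_ : t * c = q * t * p); last by rewrite /q; field; rewrite lt0r_neq0.
  rewrite expRM -powRM ?expR_ge0 ?(ltW t0)//.
  by rewrite ge0_ler_powR ?nnegrE ?mulr_ge0 ?expR_ge0 ?(ltW p0) ?(ltW t0) ?(ltW r0)//.
have tp0 : 0 < t `^ p by rewrite powR_gt0.
rewrite powRN normfV (gtr0_norm tp0).
rewrite normrM ger0_norm; last by rewrite mulr_ge0 ?expR_ge0// divr_ge0; lra.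
apply: (@le_trans _ _ (2 / alpha * expR (t * c))).
  rewrite ler_piMr ?cos_max//.
  by rewrite mulr_ge0 ?expR_ge0// divr_ge0; lra.
have -> : eps * ((t `^ p)^-1 / G) = 2 / alpha * (K / t `^ p).
  by rewrite /K; field; rewrite !lt0r_neq0//; lra.
rewrite ler_pM2l; last by rewrite divr_gt0; lra.
by rewrite ler_pdivlMr// mulrC.
Qed.
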